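(* Let $X$ be a $\sigma$-compact zero-dimensional metrizable space. Then the perfect cone $\Delta_p(X)$ over $X$ is an absolute $B_1$-retract.
   Context: Perfect cone: for a topological space $X$, the cone $\Delta(X)$ is the quotient space $(X\times[0,1])/(X\times\{0\})$ with quotient mapping $\lambda:X\times[0,1]\to\Delta(X)$; its vertex is the point $v=\lambda(X\times\{0\})$. The perfect cone $\Delta_p(X)$ is the set $\Delta(X)$ equipped with the topology $\mathcal T_p$ which coincides with the quotient topology on $\lambda(X\times(0,1])\simeq X\times(0,1]$ (an open subset), and for which the sets $\lambda(X\times[0,\varepsilon))$, $\varepsilon>0$, form a base of neighborhoods of $v$. A subset $E$ of a topological space $Y$ is a $B_1$-retract of $Y$ if there exist a sequence of continuous mappings $r_n:Y\to E$ and a mapping $r:Y\to E$ such that $r_n(y)\to r(y)$ for all $y\in Y$ and $r(y)=y$ for all $y\in E$. A space is perfectly normal if it is normal and every closed subset of it is $G_\delta$. A topological space $W$ is an absolute $B_1$-retract (in the class of perfectly normal spaces) if $W$ is perfectly normal and for any homeomorphism $h$ which maps $W$ onto a $G_\delta$-subset $h(W)$ of a perfectly normal space $Y$, the set $h(W)$ is a $B_1$-retract of $Y$. *)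

(* Defs.v *)
From HB Require Import structures.
From mathcomp Require Import all_boot all_order all_algebra.
From mathcomp Require Import all_classical all_reals all_analysis.
From mathcomp Require Import borel_hierarchy.
Import Order.TTheory GRing.Theory Num.Theory.
Import numFieldNormedType.Exports.

Set Implicit Arguments.
Unset Strict Implicit.
Unset Printing Implicit Defensive.

Local Open Scope classical_set_scope.
Local Open Scope ring_scope.
Local Open Scope quotient_scope.

Definition metrizable (R : realType) (X : topologicalType) : Prop :=
  exists d : X -> X -> R,
    [/\ forall x, d x x = 0,
        forall x y, d x y = 0 -> x = y,
        forall x y, d x y = d y x,
        forall y x z, d x z <= d x y + d y z &
        forall x, nbhs x =
          filter_from [set e : R | 0 < e] (fun e => [set y | d x y < e])].

Definition sigma_compact (X : topologicalType) : Prop :=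
  exists2 K : (set X)^nat, (forall n, compact (K n)) & \bigcup_n K n = setT.

(* [ind X <= 0]. The library's [zero_dimensional] only asks that clopen sets
   separate points, which is weaker in general. *)
Definition has_clopen_basis (X : topologicalType) : Prop :=
  exists2 B : set (set X), basis B & forall U, B U -> clopen U.

(* As in Engelking's terminology, normality includes T1; [normal_space] does
   not. *)
Definition perfectly_normal (Y : topologicalType) : Prop :=
  [/\ accessible_space Y, normal_space Y &
      forall F : set Y, closed F -> Gdelta F].

Definition homeomorphism (S T : topologicalType) (h : S -> T) : Prop :=
  continuous h /\
  exists g : T -> S, [/\ continuous g, cancel h g & cancel g h].

(* A set [E : set Y] used as a type carries the subspace topology. *)
Definition B1_retract (Y : topologicalType) (E : set Y) : Prop :=
  exists (r_ : nat -> Y -> E) (r : Y -> E),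
    [/\ forall n, continuous (r_ n),
        forall y, r_ n y @[n --> \oo] --> r y &
        forall y : E, r (set_val y) = y].

Definition absolute_B1_retract (W : topologicalType) : Prop :=
  perfectly_normal W /\
  forall (Y : topologicalType) (E : set Y) (h : W -> E),
    perfectly_normal Y -> Gdelta E -> homeomorphism h -> B1_retract E.

Section cone.
Variables (R : realType) (X : topologicalType).

Definition unit_itv : Type := `[0, 1]%classic : set R.
HB.instance Definition _ := Topological.on unit_itv.

Definition height (p : X * unit_itv) : R := set_val p.2.

Definition cone_eq (p q : X * unit_itv) : bool :=
  (p == q) || ((height p == 0) && (height q == 0)).

Lemma cone_eq_refl : reflexive cone_eq.
Proof. by move=> p; rewrite /cone_eq eqxx. Qed.

Lemma cone_eq_sym : symmetric cone_eq.
Proof. by move=> p q; rewrite /cone_eq eq_sym andbC. Qed.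

Lemma cone_eq_trans : transitive cone_eq.
Proof.
move=> q p r; rewrite /cone_eq => /orP[/eqP->//|/andP[p0 q0]].
by move=> /orP[/eqP<-|/andP[_ r0]]; rewrite p0 ?q0 ?r0 orbT.
Qed.

Definition cone_equiv := EquivRel _ cone_eq_refl cone_eq_sym cone_eq_trans.

(* If [X] is empty then so is [cone], and there is no vertex. *)
Definition cone : Type := {eq_quot cone_equiv}.
HB.instance Definition _ := Quotient.on cone.
HB.instance Definition _ := Topological.copy cone (quotient_topology cone).

Definition cone_proj : X * unit_itv -> cone := \pi_cone.

Definition punctured_cone : set cone := cone_proj @` [set p | 0 < height p].
Definition cone_ball (e : R) : set cone := cone_proj @` [set p | height p < e].

Definition perfect_cone : Type := cone.
HB.instance Definition _ := Choice.on perfect_cone.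

(* The only point of [cone] outside [punctured_cone] is the vertex; see
   [perfect_cone_open_punctured] and [nbhs_perfect_cone_vertex] below for the
   two properties that determine this topology. *)
Definition perfect_cone_open (U : set perfect_cone) : Prop :=
  open (U `&` punctured_cone : set cone) /\
  forall p, height p = 0 -> U (cone_proj p) ->
    exists2 e : R, 0 < e & cone_ball e `<=` U.

Lemma cone_projE p q : (cone_proj p = cone_proj q) <-> cone_eq p q.
Proof. by split=> [/eqmodP|pq]; [|apply/eqmodP]. Qed.

Lemma height_ge0 p : 0 <= height p.
Proof.
rewrite /height; have := set_valP p.2.
by rewrite /= in_itv/= => /andP[].
Qed.

Lemma height_continuous : continuous height.
Proof.
move=> p; apply: (@continuous_comp _ _ _ (fun p : X * unit_itv => p.2)).
  exact: cvg_snd.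
exact: initial_continuous.
Qed.

Lemma punctured_coneE p : punctured_cone (cone_proj p) <-> 0 < height p.
Proof.
split=> [[q/= q0 /cone_projE/orP[/eqP<-//|/andP[/eqP q00 _]]]|]; last by exists p.
by move: q0; rewrite q00 ltxx.
Qed.

Lemma punctured_cone_open : open punctured_cone.
Proof.
rewrite /open/= /quotient_open.
rewrite (_ : _ @^-1` _ = height @^-1` [set x | 0 < x]).
  by apply: open_comp => [? _|]; [exact: height_continuous|exact: open_gt].
by apply/seteqP; split=> p /punctured_coneE.
Qed.

Lemma perfect_cone_openT : perfect_cone_open setT.
Proof.
split; first by rewrite setTI; exact: punctured_cone_open.
by move=> *; exists 1.
Qed.

Lemma perfect_cone_openI : setI_closed perfect_cone_open.
Proof.
move=> U V [oU vU] [oV vV]; split; first by rewrite setIIl; exact: openI.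
move=> p p0 [Up Vp]; have [e e0 eU] := vU _ p0 Up.
have [f f0 fV] := vV _ p0 Vp; exists (Num.min e f).
  by rewrite lt_min e0.
by move=> _ [q + <-]; rewrite /= lt_min => /andP[qe qf]; split;
  [apply: eU|apply: fV]; exists q.
Qed.

Lemma perfect_cone_open_bigU (I : Type) (f : I -> set perfect_cone) :
  (forall i, perfect_cone_open (f i)) -> perfect_cone_open (\bigcup_i f i).
Proof.
move=> fo; split.
  by rewrite setI_bigcupl; apply: bigcup_open => i _; have [] := fo i.
move=> p p0 [i _ fip]; have [_ /(_ _ p0 fip) [e e0 ef]] := fo i.
by exists e => // q /ef ?; exists i.
Qed.

HB.instance Definition _ := isOpenTopological.Build perfect_cone
  perfect_cone_openT perfect_cone_openI perfect_cone_open_bigU.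

Lemma perfect_cone_open_punctured (U : set cone) : U `<=` punctured_cone ->
  open (U : set perfect_cone) <-> open U.
Proof.
move=> /[dup] UP /setIidl UE; split=> [|oU].
  by rewrite {1}/open/= /perfect_cone_open UE => -[].
split; first by rewrite UE.
by move=> p p0 /UP/punctured_coneE; rewrite p0 ltxx.
Qed.

Lemma nbhs_perfect_cone_vertex (p : X * unit_itv) : height p = 0 ->
  nbhs (cone_proj p : perfect_cone) =
  filter_from [set e : R | 0 < e] (cone_ball : R -> set perfect_cone).
Proof.
move=> p0; apply/seteqP; split=> U.
  by rewrite nbhsE => -[V [[_ +] Vp] VU] => /(_ _ p0 Vp)[e e0 eV]; exists e => //;
    exact: subset_trans VU.
move=> [e /= e0 eU]; rewrite nbhsE; exists (cone_ball e : set perfect_cone) => //.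
split; last by exists p => //=; rewrite p0.
split; last by move=> *; exists e.
apply: openI punctured_cone_open; rewrite /open/= /quotient_open.
rewrite (_ : _ @^-1` _ = height @^-1` [set x | x < e]).
  by apply: open_comp => [? _|]; [exact: height_continuous|exact: open_lt].
apply/seteqP; split=> q; last by exists q.
by move=> [r /= re /cone_projE/orP[/eqP<-//|/andP[_ /eqP/= ->]]].
Qed.

End cone.

(* Main.v *)
Require Import Defs.
From mathcomp Require Import all_boot all_order all_algebra.
From mathcomp Require Import all_classical all_reals all_analysis.
From mathcomp Require Import borel_hierarchy.
From mathcomp Require Import lra.
Import Order.TTheory GRing.Theory Num.Theory.
Import numFieldNormedType.Exports.
Set Implicit Arguments.
Unset Strict Implicit.
Unset Printing Implicit Defensive.
Local Open Scope classical_set_scope.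
Local Open Scope ring_scope.

(** Write [W] for the perfect cone over [X] and let [h] embed [W] as a
    [G_delta] subset [E] of a perfectly normal space [Y].

    That [W] itself is perfectly normal holds because it is metrizable: if [d]
    is a metric of [X] bounded by 1, then
    [|s - t| + min s t * d x y] is a metric for the perfect cone
    ([perfect_cone_metrizable]).

    For the retraction, the point is that [E] and its complement are both
    countable increasing unions of closed subsets of [Y].  The complement is
    [F_sigma] because [E] is [G_delta].  And [X] is the union of an increasing
    sequence of compact sets [K_n], so [E] is the union of the sets [F_n], the
    images of the cones over [K_n]; each [F_n] is compact, hence closed in the
    Hausdorff space [Y].  Let [C_n] be closed sets that increase to the
    complement of [E].  Suppose that a continuous [r_n : Y -> E] sends [C_n] to
    the vertex and moves every point of [F_n] by little, say from [h (x, t)] to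
    [h (c, t)] with [d c x < 1 / (n + 1)].  Then [r_n] converges pointwise: on
    [E] to the identity, and off [E] to the vertex, where it is eventually
    constant.

    Such an [r_n] exists because zero-dimensionality allows to shrink the cone
    onto a fan with finitely many legs.  The compact set [K_n] is covered by
    finitely many pairwise disjoint small clopen sets [V_i]
    ([compact_clopen_partition]), with a nearby point [c_i] each.  The
    function that equals [t] at [h (x, t)] when [x] lies in [V_i], and 0
    elsewhere, is continuous on the closed set formed by [F_n] and [C_n].
    These functions have disjoint cozero sets, and Tietze's theorem extends
    them to functions [g_i] on [Y] that still have disjoint cozero sets
    ([disjoint_tietze_extension]).  The map that follows the leg over [c_i] at
    height [g_i] wherever [g_i > 0], and is at the vertex elsewhere, is the
    map wanted ([fan_map], [cone_approximation]). *)

(** * Metrizable spaces are perfectly normal *)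

Lemma dist_ge0 (R : realType) (X : Type) (d : X -> X -> R) :
  (forall x, d x x = 0) -> (forall x y, d x y = d y x) ->
  (forall y x z, d x z <= d x y + d y z) -> forall x y, 0 <= d x y.
Proof.
by move=> d0 d_sym d_tri x y; have := d_tri y x x; rewrite d0 (d_sym y x); lra.
Qed.

Lemma metrizable_perfectly_normal (R : realType) (X : topologicalType) :
  metrizable R X -> perfectly_normal X.
Proof.
move=> [d [d0 d_eq0 d_sym d_tri d_nbhs]].
have d_ge0 := dist_ge0 d0 d_sym d_tri.
have ball_open x e : open [set y | d x y < e].
  rewrite openE => y /= xy; rewrite /interior d_nbhs.
  exists (e - d x y) => /=; first by rewrite subr_gt0.
  by move=> z /= yz; have := d_tri y x z; lra.
have nbhs_sub x (A : set X) :
    nbhs x A -> exists2 e : R, 0 < e & forall y, d x y < e -> A y.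
  by rewrite d_nbhs => -[e /= e0 eA]; exists e.
split.
- move=> x y /eqP xy; exists [set z | d x z < d x y]; split.
  + exact: ball_open.
  + rewrite inE /= d0 lt_neqAle d_ge0 andbT.
    by apply/eqP => /esym /d_eq0.
  + by rewrite inE /= ltxx.
- apply/(@normal_openP R) => A B cA cB AB0.
  (* The balls about points [a] of [S] whose double misses [T]: as the radii
     are at most half the distance to the other set, two balls of the hulls of
     [A] and [B] cannot meet. *)
  pose hull (S T : set X) := \bigcup_(p in [set p : X * R |
    S p.1 /\ forall b, T b -> 2 * p.2 <= d p.1 b]) [set y | d p.1 y < p.2].
  have hull_sub S T : closed T -> S `&` T = set0 -> S `<=` hull S T.
    move=> cT ST0 x Sx; have : nbhs x (~` T).
      apply: open_nbhs_nbhs; split; first exact: closed_openC.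
      by move=> Tx; have : set0 x by rewrite -ST0.
    move=> /nbhs_sub[e e0 eT]; exists (x, e / 2) => /=; last first.
      by rewrite d0 divr_gt0.
    split => // b Tb; rewrite leNgt; apply/negP => xb.
    by apply: (eT b) => //; lra.
  exists (hull A B), (hull B A); split.
  + by apply: bigcup_open => p _; exact: ball_open.
  + by apply: bigcup_open => p _; exact: ball_open.
  + exact: hull_sub.
  + by apply: hull_sub => //; rewrite setIC.
  + rewrite -subset0 => z [[[a e]/= [Aa aB] az] [[b f]/= [Bb bA] bz]].
    have := aB _ Bb; have := bA _ Aa; have := d_tri z a b.
    by rewrite (d_sym z b) (d_sym b a); lra.
- move=> F cF; exists (fun n => \bigcup_(x in F) [set y | d x y < n.+1%:R^-1]).
    by move=> n; apply: bigcup_open => x _; exact: ball_open.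
  apply/seteqP; split=> [x Fx n _|x xF]; first by exists x; rewrite /= ?d0 ?invr_gt0.
  apply: cF => A /nbhs_sub[e e0 eA].
  have [n ne] : exists n, n.+1%:R^-1 < e.
    by near \oo => n; exists n; near: n; exact: near_infty_natSinv_lt (PosNum e0).
  have [y Fy yx] := xF n I; exists y; split=> //; apply: eA.
  by rewrite d_sym; apply: lt_trans ne.
Unshelve. all: by end_near.
Qed.

(** * The topology of the perfect cone and its metric *)

Section cone_metric.
Variables (R : realType) (X : topologicalType).
Local Notation I := (unit_itv R).
Local Notation W := (perfect_cone R X).
Local Notation proj := (@cone_proj R X).

Lemma height_le1 (p : X * I) : height p <= 1.
Proof.
by rewrite /height; have := set_valP p.2; rewrite /= in_itv/= => /andP[].
Qed.

Lemma height_inj (x : X) (t u : I) : height (x, t) = height (x, u) -> t = u.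
Proof. exact: val_inj. Qed.

Lemma cone_proj_inj (p q : X * I) : 0 < height p -> proj p = proj q -> p = q.
Proof.
move=> p0 /cone_projE/orP[/eqP//|/andP[/eqP pz _]].
by rewrite pz ltxx in p0.
Qed.

Lemma cone_proj_vertex (p q : X * I) :
  height p = 0 -> height q = 0 -> proj p = proj q.
Proof. by move=> p0 q0; apply/cone_projE; rewrite /cone_eq p0 q0 eqxx orbT. Qed.

Lemma cone_proj_surj (w : W) : exists p, w = proj p.
Proof. by exists (repr w); rewrite /cone_proj reprK. Qed.

Lemma height0_or (p : X * I) : height p = 0 \/ 0 < height p.
Proof.
by have := height_ge0 p; rewrite le_eqVlt => /orP[/eqP ->|]; [left|right].
Qed.

(** Away from the vertex the projection is an open embedding, so that local
    questions there can be settled in [X * [0, 1]]. *)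
Lemma nbhs_cone_proj (p : X * I) : 0 < height p ->
  nbhs (proj p : W) = proj @ nbhs p.
Proof.
move=> p0; apply/seteqP; split=> U.
  rewrite nbhsE => -[V [[oV _] Vp] VU].
  have : open (proj @^-1` (V `&` @punctured_cone R X)) by exact: oV.
  move=> oV'; rewrite nbhsE; exists (proj @^-1` (V `&` @punctured_cone R X)).
    by split=> //; split=> //; exact/punctured_coneE.
  by move=> q [/VU].
move=> pU; have : nbhs p (proj @^-1` U `&` [set q | 0 < height q]).
  apply: filterI => //; apply: open_nbhs_nbhs; split=> //.
  by apply: open_comp (@open_gt R 0) => q _; exact: height_continuous.
rewrite nbhsE => -[G [oG Gp] GU]; rewrite nbhsE.
exists (proj @` G); last by move=> _ [q /GU[? _] <-].
split; last by exists p.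
apply/perfect_cone_open_punctured.
  by move=> _ [q /GU[_ q0] <-]; exact/punctured_coneE.
rewrite /open/= /quotient_open (_ : _ @^-1` _ = G)//.
apply/seteqP; split=> [q [r Gr /cone_proj_inj <-//]|q Gq]; last by exists q.
by have [] := GU _ Gr.
Qed.

Lemma cone_proj_continuous : continuous (proj : X * I -> W).
Proof.
move=> p; have [p0|p0] := height0_or p; last first.
  by move=> U; rewrite [X in X U -> _](nbhs_cone_proj p0).
move=> U; rewrite [X in X U -> _](nbhs_perfect_cone_vertex p0) => -[e /= e0 eU].
have : nbhs p [set q | height q < e].
  apply: open_nbhs_nbhs; split; last by rewrite /= p0.
  by apply: open_comp (@open_lt R e) => q _; exact: height_continuous.
by apply: filterS => q qe; apply: eU; exists q.
Qed.

(** The triangle inequality of [cone_dist].  The only case in which a factor on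
    the right is too small is a path through a height [t] below both [s] and
    [u]; then the descent to [t] and back costs an extra [2 * (min s u - t)],
    which makes up for the loss of [(min s u - t) * c] because [c <= 1]. *)
Lemma min_interpolation_triangle (s t u a b c : R) :
  0 <= s -> 0 <= t -> 0 <= u -> 0 <= a -> 0 <= b -> c <= 1 -> c <= a + b ->
  `|s - u| + Num.min s u * c
    <= `|s - t| + Num.min s t * a + (`|t - u| + Num.min t u * b).
Proof.
move=> s0 t0 u0 a0 b0 c1 cab.
have [tm|tm] := leP (Num.min s u) t.
  have h : Num.min s u * c <= Num.min s t * a + Num.min t u * b.
    have m0 : 0 <= Num.min s u by rewrite le_min s0.
    have h1 : Num.min s u * a <= Num.min s t * a.
      by rewrite ler_wpM2r// le_min tm ge_min lexx.
    have h2 : Num.min s u * b <= Num.min t u * b.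
      by rewrite ler_wpM2r// le_min tm ge_min lexx orbT.
    by have := ler_wpM2l m0 cab; rewrite mulrDr; lra.
  have := ler_distD t s u; lra.
move: (tm); rewrite lt_min => /andP[ts tu].
rewrite (min_r (ltW ts)) (min_l (ltW tu)) (gtr0_norm (x := s - t)) ?subr_gt0//.
rewrite (ltr0_norm (x := t - u)) ?subr_lt0//.
have h1 : t * c <= t * (a + b) by exact: ler_wpM2l.
have h2 : (Num.min s u - t) * c <= Num.min s u - t.
  by rewrite -[leRHS]mulr1 ler_wpM2l// subr_ge0 ltW.
suff : `|s - u| + 2 * Num.min s u <= s + u by lra.
by case: (leP s u) => su; [rewrite ler0_norm; lra|rewrite gtr0_norm; lra].
Qed.

Variable d : X -> X -> R.
(** The factor [min] shrinks the copy of [X] at height [t] to diameter at most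
    [t], so that the balls about the vertex are exactly the sets
    [cone_ball]. *)
Definition cone_dist (v w : W) : R :=
  let p := repr v in let q := repr w in
  `|height p - height q|
    + Num.min (height p) (height q) * Num.min 1 (d p.1 q.1).

Lemma cone_dist_proj (p q : X * I) : cone_dist (proj p) (proj q) =
  `|height p - height q|
    + Num.min (height p) (height q) * Num.min 1 (d p.1 q.1).
Proof.
have hr r : height (repr (proj r : W)) = height r.
  have : proj (repr (proj r : W)) = proj r by rewrite /cone_proj reprK.
  by move=> /cone_projE/orP[/eqP ->//|/andP[/eqP -> /eqP ->]].
rewrite /cone_dist !hr; congr (_ + _).
have rE r : 0 < height r -> repr (proj r : W) = r.
  by move=> r0; apply: cone_proj_inj; rewrite ?hr// /cone_proj reprK.
have [p0|p0] := height0_or p; first by rewrite p0 min_l ?height_ge0// !mul0r.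
have [q0|q0] := height0_or q; first by rewrite q0 min_r ?height_ge0// !mul0r.
by rewrite !rE.
Qed.

Hypotheses (d0 : forall x, d x x = 0)
  (d_sym : forall x y, d x y = d y x)
  (d_tri : forall y x z, d x z <= d x y + d y z)
  (d_nbhs : forall x, nbhs x =
     filter_from [set e : R | 0 < e] (fun e => [set y | d x y < e])).

Let d_ge0 : forall x y, 0 <= d x y := dist_ge0 d0 d_sym d_tri.

Lemma nbhs_cone_dist (w : W) : nbhs w =
  filter_from [set e : R | 0 < e] (fun e => [set v | cone_dist w v < e]).
Proof.
have [p ->] := cone_proj_surj w; have [p0|p0] := height0_or p.
  rewrite nbhs_perfect_cone_vertex//; congr filter_from; apply/funext => e.
  have D q : cone_dist (proj p) (proj q) = height q.
    rewrite cone_dist_proj p0 sub0r normrN ger0_norm ?height_ge0//.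
    by rewrite min_l ?height_ge0// mul0r addr0.
  apply/seteqP; split=> [_ [q /= qe <-]|v]; first by rewrite /= D.
  by have [q ->] := cone_proj_surj v; rewrite /= D => qe; exists q.
rewrite nbhs_cone_proj//; apply/seteqP; split=> U.
  move=> [[A B] /= []]; rewrite {1}d_nbhs => -[e1 /= e10 e1A].
  move=> [V [[V' oV' <-] V'p] V'B] ABU.
  have : nbhs (height p) V' by apply: open_nbhs_nbhs.
  move=> /nbhs_ballP[e2 /= e20 e2V].
  pose m := Num.min 1 e1.
  have m0 : 0 < m by rewrite lt_min ltr01.
  have hm0 : 0 < height p / 2 * m by rewrite mulr_gt0// divr_gt0.
  (* Below distance [height p / 2] the height of [q] exceeds [height p / 2],
     so the factor [min] is at least [height p / 2]; this turns the third bound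
     into [min 1 (d p.1 q.1) < m]. *)
  exists (Num.min (height p / 2) (Num.min e2 (height p / 2 * m))).
    by rewrite /= !lt_min hm0 e20 divr_gt0.
  move=> v; have [q ->] := cone_proj_surj v.
  rewrite /= cone_dist_proj !lt_min => /and3P[h1 h2 h3].
  have dm0 : 0 <= Num.min 1 (d p.1 q.1) by rewrite le_min ler01 d_ge0.
  have mm0 : 0 <= Num.min (height p) (height q) by rewrite le_min !height_ge0.
  have := mulr_ge0 mm0 dm0 => M0.
  have q2 : height p / 2 < height q.
    have := ler_norm (height p - height q); lra.
  have pqm : height p / 2 <= Num.min (height p) (height q).
    by rewrite le_min (ltW q2) andbT; lra.
  have n0 := normr_ge0 (height p - height q).
  have : height p / 2 * Num.min 1 (d p.1 q.1) < height p / 2 * m.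
    by have := ler_wpM2r dm0 pqm; lra.
  rewrite ltr_pM2l ?divr_gt0// /m => dlt.
  have de : d p.1 q.1 < e1.
    move: dlt; rewrite lt_min !gt_min ltxx/= => /andP[d1].
    by rewrite (ltNge 1 e1) => /orP[e11|//]; move: e11 d1; lra.
  apply: (ABU q); split; first exact: e1A.
  apply: V'B; apply: e2V; rewrite /ball/= -[set_val _]/(height q); lra.
move=> [e /= e0 eU].
have h1 : nbhs p [set q | `|height p - height q| < e / 2].
  have := @height_continuous R X p; move/cvgrPdist_lt; apply.
  by rewrite divr_gt0.
have h2 : nbhs p [set q | d p.1 q.1 < e / 2].
  have : nbhs p.1 [set y | d p.1 y < e / 2].
    by rewrite d_nbhs; exists (e / 2) => //=; rewrite divr_gt0.
  exact: (@cvg_fst _ _ (nbhs p.1) (nbhs p.2)).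
apply: filterS (filterI h1 h2) => q [/= q1 q2]; apply: eU => /=.
rewrite cone_dist_proj.
have : Num.min (height p) (height q) * Num.min 1 (d p.1 q.1) <= 1 * d p.1 q.1.
  apply: ler_pM; rewrite ?le_min ?height_ge0 ?ler01 ?d_ge0//.
    by rewrite ge_min height_le1.
  by rewrite ge_min lexx orbT.
lra.
Qed.

End cone_metric.

Lemma perfect_cone_metrizable (R : realType) (X : topologicalType) :
  metrizable R X -> metrizable R (perfect_cone R X).
Proof.
move=> [d [d0 d_eq0 d_sym d_tri d_nbhs]].
have dge0 := dist_ge0 d0 d_sym d_tri.
exists (@cone_dist R X d); split.
- by move=> w; rewrite /cone_dist d0 subrr normr0 (min_r ler01) mulr0 addr0.
- move=> v w; have [p ->] := cone_proj_surj v; have [q ->] := cone_proj_surj w.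
  rewrite cone_dist_proj => /eqP; rewrite paddr_eq0 ?normr_ge0//; last first.
    by rewrite mulr_ge0// le_min ?height_ge0 ?ler01 ?dge0.
  rewrite normr_eq0 subr_eq0 => /andP[/eqP pq].
  have [p0 _|p0] := height0_or p; first by apply: cone_proj_vertex; rewrite -?pq.
  rewrite -pq minxx mulf_eq0 gt_eqF//= => /eqP m0.
  have d00 : d p.1 q.1 = 0.
    by move: m0; case: (leP 1 (d p.1 q.1)) => // _ /eqP; rewrite oner_eq0.
  congr cone_proj; move: p q pq d00 {p0 m0} => [x s] [y t] /= st /d_eq0 xy.
  by move: st; rewrite xy => /height_inj ->.
- by move=> v w; rewrite /cone_dist distrC minC d_sym.
- move=> v u w; rewrite /cone_dist; apply: min_interpolation_triangle;
    rewrite ?height_ge0 ?le_min ?ler01 ?dge0// ?ge_min ?lexx//.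
  have abc := d_tri (repr v).1 (repr u).1 (repr w).1.
  have := dge0 (repr u).1 (repr v).1; have := dge0 (repr v).1 (repr w).1.
  by case: (leP 1 (d (repr u).1 _)) => ?; case: (leP 1 (d (repr v).1 _)) => ? ? ?;
    apply/orP; (left; lra) || (right; lra).
- exact: nbhs_cone_dist.
Qed.

(** * Clopen partitions of compact sets *)

(** Given a finite clopen cover, removing from each member the previous ones
    makes it disjoint, and keeps it clopen.  The point [c i] need not lie in
    what remains of its neighborhood. *)
Lemma compact_clopen_partition (X : topologicalType) (K : set X)
    (U : X -> set X) : has_clopen_basis X -> compact K ->
  (forall x, nbhs x (U x)) ->
  exists (k : nat) (V : 'I_k -> set X) (c : 'I_k -> X),
    [/\ forall i, clopen (V i), forall i, V i `<=` U (c i),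
        forall i j x, V i x -> V j x -> i = j &
        forall x, K x -> exists i, V i x].
Proof.
move=> [B [_ Bnbhs] Bclopen] cK Unbhs.
have /choice[N N_prop] x : exists N, [/\ clopen N, N x & N `<=` U x].
  have [N [/= BN Nx] NU] := Bnbhs x _ (Unbhs x).
  by exists N; split => //; exact: Bclopen.
have [s Ks] : exists s : seq X, forall y, K y -> exists2 x, x \in s & N x y.
  (* The finite subcover comes from the near covering property of [K] along
     the filter of the finite lists ordered by inclusion. *)
  pose F := filter_from [set: seq X] (fun s0 => [set s : seq X | {subset s0 <= s}]).
  have FF : Filter F.
    apply: filter_from_filter; first by exists [::].
    move=> s1 s2 _ _; exists (s1 ++ s2) => // s /= s12; split=> x xs;
      by apply: s12; rewrite mem_cat xs ?orbT.
  have /compact_near_coveringP := cK.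
  move=> /(_ (seq X) F (fun s y => exists2 x, x \in s & N x y) FF) [].
    move=> x Kx; have [[oN _] Nx _] := N_prop x.
    exists (N x, [set s | x \in s]) => /=; last first.
      by move=> [y s] [/= Ny xs]; exists x.
    split; first by apply: open_nbhs_nbhs.
    by exists [:: x] => // s /= /(_ x); apply; rewrite mem_head.
  by move=> s _ Ks; exists s => y Ky; apply: (Ks s) => // x.
pose c (i : 'I_(size s)) := tnth (in_tuple s) i.
pose V i := N (c i) `\` \bigcup_(j in [set j : 'I_(size s) | (j < i)%N]) N (c j).
have cN i : clopen (N (c i)) by have [] := N_prop (c i).
exists (size s), V, c; split.
- move=> i; split.
    apply: openI; first by have [] := cN i.
    apply: closed_openC; apply: closed_bigcup; first exact: finite_finset.
    by move=> j _; have [] := cN j.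
  apply: closedI; first by have [] := cN i.
  by apply: open_closedC; apply: bigcup_open => j _; have [] := cN j.
- by move=> i x [+ _]; have [_ _] := N_prop (c i); exact.
- move=> i j x [Ni iN] [Nj jN]; apply/val_inj.
  by case: (ltngtP i j) => // ij; [case: jN; exists i|case: iN; exists j].
- move=> x /Ks[y ys Ny].
  have [i0 yE] : exists i0, y = c i0 by apply/tnthP; rewrite memtE.
  have P0 : `[<N (c i0) x>] by apply/asboolP; rewrite -yE.
  case: (@arg_minnP _ i0 (fun i => `[<N (c i) x>]) val P0) => i /asboolP Ni imin.
  exists i; split=> // -[j /= ji Nj].
  by have := imin j; rewrite leqNgt ji; move/(_ (asboolT Nj)).
Qed.

(** * Extension of functions with disjoint cozero sets *)

(** Arbitrary Tietze extensions [F i] of the [f i] may overlap.  Subtracting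
    from [|F i|] all the other [|F j|] and keeping the positive part makes the
    cozero sets disjoint, since at most one term can exceed the sum of the
    others; where the [f i] were disjoint already, nothing changes. *)
Lemma disjoint_tietze_extension (R : realType) (Y : topologicalType) (k : nat)
    (A : set Y) (f : 'I_k -> Y -> R) :
  normal_space Y -> closed A ->
  (forall i, {within A, continuous (f i)}) ->
  (forall i y, A y -> 0 <= f i y <= 1) ->
  (forall i j y, A y -> 0 < f i y -> 0 < f j y -> i = j) ->
  exists g : 'I_k -> Y -> R,
    [/\ forall i, continuous (g i), forall i y, 0 <= g i y <= 1,
        forall i j y, 0 < g i y -> 0 < g j y -> i = j &
        forall i y, A y -> g i y = f i y].
Proof.
move=> nY cA fc f01 fdisj.
have /choice[F F_prop] i : exists F : Y -> R,
    [/\ continuous F, forall y, `|F y| <= 1 & forall y, A y -> F y = f i y].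
  have [|F [fF Fc F1]] := continuous_bounded_extension nY cA ltr01 (fc i).
    by move=> y Ay; have /andP[f0 f1] := f01 i y Ay; rewrite ger0_norm.
  by exists F; split=> // y Ay; rewrite fF// inE.
(* The sum includes [j = i], whence the factor 2. *)
pose g i y := Num.max 0 (2 * `|F i y| - \sum_(j < k) `|F j y|).
have sum_split i y : \sum_(j < k) `|F j y| =
    `|F i y| + \sum_(j < k | j != i) `|F j y| by rewrite (bigD1 i).
have rest_ge0 i y : 0 <= \sum_(j < k | j != i) `|F j y| by exact: sumr_ge0.
have g_gt0 i y : (0 < g i y) = (\sum_(j < k | j != i) `|F j y| < `|F i y|).
  by rewrite /g (sum_split i) lt_max ltxx/= subr_gt0 mulrDl mul1r ltrD2l.
exists g; split.
- move=> i y; apply: (@continuous_max R Y (fun=> 0)); first exact: cst_continuous.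
  have Fn j : continuous (fun y => `|F j y|).
    move=> z; apply: (@cvg_norm _ R^o); have [+ _ _] := F_prop j; exact.
  apply: cvgB; first by apply: cvgM; [exact: cvg_cst|exact: Fn].
  apply: (@cvg_big R^o _ +%R) => [|j _]; [exact: add_continuous|exact: Fn].
- move=> i y; rewrite /g le_max lexx/= ge_max ler01/= (sum_split i).
  by have [_ /(_ y) + _] := F_prop i; have := rest_ge0 i y; lra.
- move=> i j y; rewrite !g_gt0 => gi gj; apply/eqP; apply: contraT => ij.
  have le_rest a b : b != a ->
      `|F b y| <= \sum_(l < k | l != a) `|F l y|.
    by move=> ba; rewrite (bigD1 b)//= lerDl sumr_ge0.
  have := le_rest j i ij; have := le_rest i j; rewrite eq_sym ij => /(_ isT).
  lra.
- move=> i y Ay.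
  have FE j : `|F j y| = f j y.
    have [_ _ ->//] := F_prop j; rewrite ger0_norm//.
    by have /andP[] := f01 j y Ay.
  rewrite /g (sum_split i); under eq_bigr do rewrite FE.
  rewrite FE; have /andP[fi0 _] := f01 i y Ay.
  have : 0 <= \sum_(j < k | j != i) f j y.
    by apply: sumr_ge0 => j _; have /andP[] := f01 j y Ay.
  move: fi0; rewrite le_eqVlt => /orP[/eqP<- ?|fi0 _].
    by apply/max_idPl; lra.
  rewrite big1 => [|j ji].
    by rewrite addr0 mulrDl mul1r addrK max_r// ltW.
  apply/eqP; rewrite eq_le; have /andP[-> _] := f01 j y Ay; rewrite andbT leNgt.
  by apply: contraNN ji => fj0; rewrite (fdisj j i y Ay fj0 fi0).
Qed.

(** * Fans in the perfect cone *)

Section fans.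
Variables (R : realType) (X : topologicalType).
Local Notation I := (unit_itv R).
Local Notation W := (perfect_cone R X).
Local Notation proj := (@cone_proj R X).

Lemma clamp_itv (x : R) : Num.max 0 (Num.min 1 x) \in (`[0, 1]%classic : set R).
Proof. by rewrite inE/= in_itv/= le_max lexx ge_max ler01 ge_min lexx. Qed.

Definition clamp (x : R) : I := SigSub (clamp_itv x).

Lemma height_clamp (c : X) (x : R) : 0 <= x <= 1 -> height (c, clamp x) = x.
Proof.
by move=> /andP[x0 x1]; rewrite /height/= /set_val/= min_r// max_r.
Qed.

Lemma clamp_height (p : X * I) : clamp (height p) = p.2.
Proof.
apply: (@height_inj R X p.1).
by rewrite height_clamp ?height_ge0 ?height_le1//; case: p.
Qed.

Lemma clamp_continuous : continuous clamp.
Proof.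
apply: continuous_comp_initial => x.
apply: (@continuous_max R R (fun=> 0)); first exact: cst_continuous.
by apply: (@continuous_min R R (fun=> 1)); [exact: cst_continuous|exact: cvg_id].
Qed.

Lemma unit_itv_compact : compact [set: I].
Proof.
have -> : [set: I] = clamp @` `[0, 1].
  apply/seteqP; split=> // t _; exists (set_val t); first exact: set_valP.
  apply: val_inj => /=; have := set_valP t; rewrite /= in_itv/= => /andP[t0 t1].
  by rewrite min_r// max_r.
apply: continuous_compact; last exact: segment_compact.
by apply: continuous_subspaceT => x; exact: clamp_continuous.
Qed.

Lemma cone_compact (K : set X) :
  compact K -> compact (proj @` (K `*` setT) : set W).
Proof.
move=> cK; apply: (@continuous_compact _ W); last first.
  by apply: compact_setX => //; exact: unit_itv_compact.
apply: continuous_subspaceT; exact: cone_proj_continuous.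
Qed.

(** The height on the part of the cone over [V], and 0 on the rest; when [V]
    is one block of a clopen partition, it is the coordinate along the leg onto
    which the cone over [V] is shrunk. *)
Definition cone_coord (V : set X) (w : W) : R :=
  height (repr w) * \1_V (repr w).1.

Lemma cone_coordE (V : set X) (p : X * I) :
  cone_coord V (proj p) = height p * \1_V p.1.
Proof.
have : proj (repr (proj p : W)) = proj p by rewrite /cone_proj reprK.
rewrite /cone_coord => /cone_projE/orP[/eqP ->//|/andP[/eqP -> /eqP ->]].
by rewrite !mul0r.
Qed.

Lemma cone_coord_itv (V : set X) (w : W) : 0 <= cone_coord V w <= 1.
Proof.
have [p ->] := cone_proj_surj w; rewrite cone_coordE indicE.
by case: (_ \in _); rewrite ?mulr1 ?mulr0 ?lexx ?ler01// height_ge0 height_le1.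
Qed.

Lemma cone_coord_gt0 (V : set X) (p : X * I) :
  0 < cone_coord V (proj p) -> V p.1.
Proof.
rewrite cone_coordE indicE; have [/set_mem//|_] := boolP (_ \in _).
by rewrite mulr0 ltxx.
Qed.

(** At a positive height the indicator of the clopen set [V] is locally
    constant; at the vertex the bound by the height, which tends to 0, is
    enough. *)
Lemma cone_coord_continuous (V : set X) :
  clopen V -> continuous (cone_coord V : W -> R^o).
Proof.
move=> [oV cV] w; have [p ->] := cone_proj_surj w.
have [p0|p0] := height0_or p.
  apply/(@cvgrPdist_lt R R^o W _ (nbhs_filter (proj p : W))) => e e0.
  have : nbhs (proj p : W) (cone_ball e).
    by rewrite nbhs_perfect_cone_vertex//; exists e.
  move=> B; refine (@filterS W _ (nbhs_filter (proj p : W)) _ _ _ B) => _ [q /= qe <-].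
  rewrite !cone_coordE p0 mul0r sub0r normrN.
  rewrite ger0_norm; last first.
    by have /andP[+ _] := cone_coord_itv V (proj q); rewrite cone_coordE.
  apply: le_lt_trans qe; rewrite indicE; case: (_ \in _); rewrite ?mulr1// mulr0.
  exact: height_ge0.
rewrite /continuous_at nbhs_cone_proj//.
have Vnear : \forall q \near p, \1_V q.1 = \1_V p.1 :> R.
  have Vp : nbhs p.1 [set y | \1_V y = \1_V p.1 :> R].
    have [Vp|nVp] := pselect (V p.1).
      have : nbhs p.1 V by apply: open_nbhs_nbhs.
      by apply: filterS => y Vy; rewrite /= !indicE !mem_set.
    have : nbhs p.1 (~` V) by apply: open_nbhs_nbhs; split=> //; exact: closed_openC.
    by apply: filterS => y Vy; rewrite /= !indicE !memNset.
  exact: (@cvg_fst _ _ (nbhs p.1) (nbhs p.2) _ _ Vp).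
rewrite cone_coordE.
have : (fun q : X * I => height q * \1_V p.1) @ nbhs p --> height p * \1_V p.1.
  by apply: cvgM; [exact: height_continuous|exact: cvg_cst].
move=> C; change ((fun q => cone_coord V (proj q)) @ nbhs p --> height p * \1_V p.1).
apply: cvg_trans C; apply: near_eq_cvg.
by apply: filterS Vnear => q /= Vq; rewrite cone_coordE Vq.
Qed.

Section fan_map.
Variables (Y : topologicalType) (k : nat) (c : 'I_k -> X) (g : 'I_k -> Y -> R).
Variable x0 : X.
(** The base point [x0] only serves to name the vertex. *)
Definition fan_map (y : Y) : W :=
  if [pick i | 0 < g i y] is Some i then proj (c i, clamp (g i y))
  else proj (x0, clamp 0).

Hypotheses (g_continuous : forall i, continuous (g i : Y -> R^o))
  (g_itv : forall i y, 0 <= g i y <= 1)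
  (g_disjoint : forall i j y, 0 < g i y -> 0 < g j y -> i = j).

Lemma fan_map_pos i y : 0 < g i y -> fan_map y = proj (c i, clamp (g i y)).
Proof.
move=> gi; rewrite /fan_map; case: pickP => [j gj|/(_ i)]; last by rewrite gi.
by rewrite (g_disjoint gj gi).
Qed.

Lemma fan_map_zero y : (forall i, g i y = 0) -> fan_map y = proj (x0, clamp 0).
Proof. by move=> g0; rewrite /fan_map; case: pickP => // i; rewrite g0 ltxx. Qed.

(** Near a point where some [g i] is positive only the leg [i] is used.  At a
    point where all [g i] vanish they are all small nearby, and this suffices
    since the neighborhoods of the vertex of the perfect cone are given by the
    height alone. *)
Lemma fan_map_continuous : continuous fan_map.
Proof.
move=> y; have [[i gi]|g0] := pselect (exists i, 0 < g i y).
  have gi_near : \forall z \near y, 0 < g i z.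
    apply: open_nbhs_nbhs; split=> //.
    by apply: open_comp (@open_gt R 0) => z _; exact: g_continuous.
  rewrite /continuous_at (fan_map_pos gi).
  have : (fun z => proj (c i, clamp (g i z)) : W) @ nbhs y -->
      (proj (c i, clamp (g i y)) : W).
    apply: (@cvg_comp _ _ _ (fun z => (c i, clamp (g i z))) (proj : _ -> W));
      last exact: cone_proj_continuous.
    apply: (@cvg_pair _ _ _ _ (nbhs (c i)) (nbhs (clamp (g i y)))).
      exact: cvg_cst.
    apply: (@cvg_comp _ _ _ (g i) clamp); last exact: clamp_continuous.
    exact: g_continuous.
  apply: cvg_trans; apply: near_eq_cvg.
  by apply: filterS gi_near => z giz; rewrite (fan_map_pos giz).
have gy0 i : g i y = 0.
  apply/eqP; rewrite eq_le; have /andP[-> _] := g_itv i y; rewrite andbT leNgt.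
  by apply/negP => gi; apply: g0; exists i.
rewrite /continuous_at fan_map_zero// nbhs_perfect_cone_vertex; last first.
  by rewrite height_clamp// lexx ler01.
move=> U [e /= e0 eU].
have : \forall z \near y, forall i, g i z < e.
  apply: filter_forall => i; apply: open_nbhs_nbhs; split; last by rewrite /= gy0.
  by apply: open_comp (@open_lt R e) => z _; exact: g_continuous.
apply: filterS => z gz; apply: eU; rewrite /fan_map; case: pickP => [i gi|_].
  by exists (c i, clamp (g i z)) => //=; rewrite height_clamp.
by exists (x0, clamp 0) => //=; rewrite height_clamp// lexx ler01.
Qed.

End fan_map.
End fans.

(** * Approximate retractions onto an embedded cone *)

Lemma perfectly_normal_hausdorff (Y : topologicalType) :
  perfectly_normal Y -> hausdorff_space Y.
Proof.
move=> [T1 nY _] x y xy; apply: contrapT => /eqP xNy.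
have [] := nY [set x] (accessible_closed_set1 T1 (x := x)) (~` [set y]).
  move=> _ ->; apply: open_nbhs_nbhs; split; last exact/eqP.
  exact: closed_openC (accessible_closed_set1 T1 (x := y)).
by move=> A Ax Ay; apply: (Ay y) => // B By; apply: xy => //; exact: Ax.
Qed.

(** Taking for [U] small balls and letting [K] and [C] grow, these maps converge
    pointwise to a retraction. *)
Lemma cone_approximation (R : realType) (X Y : topologicalType) (E : set Y)
    (h : perfect_cone R X -> E) (K : set X) (C : set Y)
    (U : X -> set X) (x0 : X) :
  homeomorphism h -> perfectly_normal Y -> has_clopen_basis X ->
  compact K -> closed C -> C `&` E = set0 -> (forall x, nbhs x (U x)) ->
  exists r : Y -> E,
    [/\ continuous r,
        forall x t, K x -> exists2 c, U c x &
          r (set_val (h (cone_proj (x, t)))) = h (cone_proj (c, t)) &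
        forall y, C y -> r y = h (cone_proj (x0, clamp 0))].
Proof.
move=> [hc [g [gc hK gK]]] pnY clopenX cK cC CE0 Unbhs.
have [_ nY _] := pnY; have hY := perfectly_normal_hausdorff pnY.
have [k [V [c [cV VU Vdisj KV]]]] := compact_clopen_partition clopenX cK Unbhs.
pose F : set Y := (set_val \o h) @` (@cone_proj R X @` (K `*` setT)).
have cF : closed F.
  apply: compact_closed => //; apply: (@continuous_compact (perfect_cone R X)).
    apply: continuous_subspaceT => w; apply: continuous_comp; first exact: hc.
    exact: initial_continuous.
  exact: cone_compact cK.
(* The coordinates along the legs, transported to [E] and set to 0 off [E];
   they are continuous on [E] and on [C], but not on [Y]. *)
pose f i y : R := oapp (cone_coord (V i) \o g) 0 (insub y : option E).
have fE i w : f i (set_val (h w)) = cone_coord (V i) w.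
  by rewrite /f valK /= hK.
have fC i y : C y -> f i y = 0.
  move=> Cy; rewrite /f insubN//; apply/negP; rewrite inE => Ey.
  by have : set0 y by rewrite -CE0.
have FUC_cases y : (F `|` C) y -> (exists w, y = set_val (h w)) \/ C y.
  by case=> [[w _ <-]|]; [left; exists w|right].
have [||i|i y /FUC_cases[[w ->]|Cy]|i j y /FUC_cases[[w ->]|Cy]
      |G [Gc G01 Gdisj GE]] := @disjoint_tietze_extension R Y k (F `|` C) f.
- exact: nY.
- exact: closedU.
- apply: withinU_continuous => //.
    apply: (@continuous_subspaceW _ _ F E).
      by move=> _ [w _ <-]; exact: set_valP.
    apply/subspace_sigL_continuousP => e.
    have -> : sigL E (f i) = cone_coord (V i) \o g.
      by apply/funext => e'; rewrite /sigL /f /= valK.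
    apply: continuous_comp; [exact: gc|exact: cone_coord_continuous].
  apply: (@subspace_eq_continuous _ _ _ (fun=> 0)); last exact: cst_continuous.
  by move=> y /set_mem Cy; rewrite /from_subspace fC.
- by rewrite fE cone_coord_itv.
- by rewrite fC// lexx ler01.
- rewrite !fE; have [p ->] := cone_proj_surj w.
  by move=> /cone_coord_gt0 Vi /cone_coord_gt0 Vj; exact: Vdisj Vi Vj.
- by rewrite fC// ltxx.
exists (h \o fan_map c G x0); split.
- move=> y; apply: continuous_comp; last exact: hc.
  exact: fan_map_continuous.
- move=> x t Kx; have [i Vi] := KV x Kx; exists (c i); first exact: VU.
  congr h; set y := set_val _.
  have Fy : (F `|` C) y.
    by left; exists (cone_proj (x, t)) => //; exists (x, t).
  have [xt0|xt0] := height0_or (x, t).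
    rewrite fan_map_zero => [|j].
      by apply: cone_proj_vertex => //; rewrite height_clamp// lexx ler01.
    by rewrite GE// fE cone_coordE xt0 mul0r.
  have Giy : G i y = height (x, t).
    by rewrite GE// fE cone_coordE indicE mem_set// mulr1.
  rewrite (@fan_map_pos _ _ _ _ _ _ _ Gdisj i) ?Giy//.
  by rewrite clamp_height.
- move=> y Cy; congr h; apply: fan_map_zero => i.
  by rewrite GE ?fC//; right.
Qed.

(** * The perfect cone is an absolute retract *)

Theorem theorem5p3 (R : realType) (X : topologicalType)
    (X_neq0 : [set: X] !=set0)
    (X_sigma_compact : sigma_compact X)
    (X_zero_dimensional : has_clopen_basis X)
    (X_metrizable : metrizable R X) :
  absolute_B1_retract (perfect_cone R X).
Proof.
split; first exact/(@metrizable_perfectly_normal R)/perfect_cone_metrizable.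
move=> Y E h pnY [G oG EG] hh.
have [x0 _] := X_neq0; have [K cK KT] := X_sigma_compact.
have [d [d0 _ d_sym _ d_nbhs]] := X_metrizable.
pose KK n := \big[setU/set0]_(i < n.+1) K i.
pose C n := \big[setU/set0]_(i < n.+1) ~` G i.
pose v : E := h (cone_proj (x0, clamp 0)).
have approx n : exists r : Y -> E,
    [/\ continuous r,
        forall x t, KK n x -> exists2 c, d c x < n.+1%:R^-1 &
          r (set_val (h (cone_proj (x, t)))) = h (cone_proj (c, t)) &
        forall y, C n y -> r y = v].
  apply: (@cone_approximation _ _ _ _ _ _ _
    (fun c : X => [set x | d c x < n.+1%:R^-1])) => //.
  - by apply: bigsetU_compact => i _; exact: cK.
  - by apply: closed_bigsetU => i _; exact: open_closedC.
  - rewrite -subset0 EG => y; rewrite /C -(bigcup_mkord n.+1 (fun i => ~` G i)).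
    by move=> [[i _ Giy] Gy]; apply: Giy; exact: Gy.
  - by move=> c; rewrite d_nbhs; exists n.+1%:R^-1; rewrite //= invr_gt0.
have [r_ r_prop] := choice approx.
exists r_, (insubd v); split; last by move=> e; exact: valKd.
  by move=> n; have [] := r_prop n.
move=> y; have [Ey|nEy] := pselect (E y).
  have [_ [g [_ _ gK]]] := hh.
  have [[x t] xt] := cone_proj_surj (g (SigSub (mem_set Ey))).
  have -> : y = set_val (h (cone_proj (x, t))) by rewrite -xt gK.
  have [N _ KNx] : (\bigcup_n K n) x by rewrite KT.
  rewrite valKd => A hA.
  have : nbhs x [set x' | A (h (cone_proj (x', t)))].
    have hc : {for x, continuous (fun x' : X => h (cone_proj (x', t)))}.
      apply: (@continuous_comp X (perfect_cone R X) E
        (fun x' => cone_proj (x', t)) h).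
        apply: (@continuous_comp _ _ (perfect_cone R X) (fun x' : X => (x', t))
          (@cone_proj R X)).
          apply: (@cvg_pair _ _ _ _ (nbhs x) (nbhs t)); first exact: cvg_id.
          exact: cvg_cst.
        exact: cone_proj_continuous.
      by have [+ _] := hh; exact.
    exact: hc.
  rewrite d_nbhs => -[e /= e0 eA].
  rewrite /nbhs/=; near=> n.
  have [_ rK _] := r_prop n; have [|c cx rc] := rK x t.
    rewrite /KK -(bigcup_mkord n.+1 K); exists N => //=.
    by rewrite ltnS; near: n; exact: nbhs_infty_ge.
  rewrite /= rc; apply: eA; rewrite /= d_sym; apply: lt_trans cx _.
  by near: n; exact: near_infty_natSinv_lt (PosNum e0).
rewrite /insubd insubN; last by apply/negP; rewrite inE.
have [N GNy] : exists N, ~ G N y.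
  by apply/existsNP => Gy; apply: nEy; rewrite EG => i _; exact: Gy.
apply: cvg_near_cst; near=> n.
have [_ _ ->//] := r_prop n.
rewrite /C -(bigcup_mkord n.+1 (fun i => ~` G i)); exists N => //=.
by rewrite ltnS; near: n; exact: nbhs_infty_ge.
Unshelve. all: by end_near.
Qed.
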